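(* Let $\ell\ge1$ and $i,j\in\{1,\dots,\ell\}$. The adjoint action of the elements $S^B_i\in O_{2\ell+1}$ on $\mathfrak{so}_{2\ell+1}$ satisfies $$\mathrm{Ad}_{S^B_i}(e_j)=\begin{cases} f_j,& i=j\\ e_j,&|i-j|>1\\ -\frac{(-1)^{\delta_{i,1}}}{|a_{ij}|!}\,\mathrm{ad}_{e_i}^{-a_{ij}}(e_j),& i-j=-1\\ \mathrm{ad}_{e_i}(e_j),& i-j=1\end{cases} \qquad\text{and}\qquad \mathrm{Ad}_{S^B_i}(f_j)=\begin{cases} e_j,& i=j\\ f_j,&|i-j|>1\\ \frac{1}{|a_{ij}|!}\,\mathrm{ad}_{f_i}^{-a_{ij}}(f_j),& i-j=-1\\ -\mathrm{ad}_{f_i}(f_j),& i-j=1.\end{cases}$$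
   Context: $\mathrm{Ad}_g(X)=gXg^{-1}$, $\mathrm{ad}_X(Y)=[X,Y]$, $\delta_{i,1}$ is the Kronecker delta, $e_{ab}$ are the standard $(2\ell+1)\times(2\ell+1)$ matrix units. $\mathfrak{so}_{2\ell+1}=\{X\in\mathfrak{gl}_{2\ell+1}(\mathbb C): X=-\mathcal S X^\tau\mathcal S^{-1}\}$ and $O_{2\ell+1}=\{g\in GL_{2\ell+1}(\mathbb C): g=\mathcal S(g^\tau)^{-1}\mathcal S^{-1}\}$, where $(X^\tau)_{ij}=X_{2\ell+2-j,\,2\ell+2-i}$, $\mathcal S=\mathrm{diag}(1,-1,\ldots,-1,1)$. Chevalley generators: $e_1=\sqrt2(e_{\ell,\ell+1}+e_{\ell+1,\ell+2})$, $f_1=\sqrt2(e_{\ell+1,\ell}+e_{\ell+2,\ell+1})$, and for $1<k\le\ell$: $e_k=e_{\ell+1-k,\ell+2-k}+e_{\ell+k,\ell+1+k}$, $f_k=e_{\ell+2-k,\ell+1-k}+e_{\ell+1+k,\ell+k}$. Cartan matrix: $a_{ii}=2$, $a_{12}=-2$, $a_{21}=-1$, $a_{i,i+1}=a_{i+1,i}=-1$ for $i\ge2$, $a_{ij}=0$ for $|i-j|>1$. With $T_i$ the diagonal matrix having $-1$ at place $i$ and $1$ elsewhere, $S_i$ the permutation matrix of $(i\;i+1)$ and $\overline S_i=T_iS_iT_i^{-1}$: $S_1^B=S_{\ell+1}S_\ell S_{\ell+1}$, $S^B_k=S_{\ell+1-k}\overline S_{\ell+k}$ for $1<k\le\ell$.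 *)

(* Defs.v *)
From mathcomp Require Import all_boot all_order all_algebra.

Set Implicit Arguments.
Unset Strict Implicit.
Unset Printing Implicit Defensive.

Import Order.TTheory GRing.Theory Num.Theory.
Local Open Scope ring_scope.

Section LieMatrices.

Variables (C : fieldType) (n : nat).
Implicit Types g X Y : 'M[C]_n.

Definition lie_bracket X Y : 'M[C]_n := X *m Y - Y *m X.

Definition ad X : 'M[C]_n -> 'M[C]_n := lie_bracket X.

Definition Ad g X : 'M[C]_n := g *m X *m invmx g.

(* Reflection in the antidiagonal: with indices from 1 to n,
   (X^tau)_(i, j) = X_(n + 1 - j, n + 1 - i). *)
Definition antitr X : 'M[C]_n := \matrix_(i, j) X (rev_ord j) (rev_ord i).

(* diag(1, -1, 1, ...) *)
Definition sgn_mx : 'M[C]_n := diag_mx (\row_j (-1) ^+ j).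

Definition in_so X : Prop := X = - (sgn_mx *m antitr X *m invmx sgn_mx).

Definition in_O g : Prop :=
  g \in unitmx /\ g = sgn_mx *m invmx (antitr g) *m invmx sgn_mx.

End LieMatrices.

(* Rows, columns and generators are numbered from 1, so the index a is the
   ordinal of value a.-1. The definitions are meaningful only for indices in
   range: 1 <= a, b, i <= 2l+1 (with i <= 2l for transpositions) and
   1 <= k <= l; inord sends anything out of range to the first index. *)
Section TypeB.

Variables (C : numClosedFieldType) (l : nat).

Definition idx (a : nat) : 'I_(2 * l).+1 := inord a.-1.

Definition munit (a b : nat) : 'M[C]_((2 * l).+1) := delta_mx (idx a) (idx b).

Definition chev_e (k : nat) : 'M[C]_((2 * l).+1) :=
  if k == 1%N then sqrtC 2 *: (munit l l.+1 + munit l.+1 l.+2)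
  else munit (l + 1 - k) (l + 2 - k) + munit (l + k) (l + 1 + k).

Definition chev_f (k : nat) : 'M[C]_((2 * l).+1) :=
  if k == 1%N then sqrtC 2 *: (munit l.+1 l + munit l.+2 l.+1)
  else munit (l + 2 - k) (l + 1 - k) + munit (l + 1 + k) (l + k).

Definition Tmx (i : nat) : 'M[C]_((2 * l).+1) :=
  diag_mx (\row_j (if j == idx i then -1 else 1)).

Definition Smx (i : nat) : 'M[C]_((2 * l).+1) := tperm_mx (idx i) (idx i.+1).

Definition Sbar (i : nat) : 'M[C]_((2 * l).+1) :=
  Tmx i *m Smx i *m invmx (Tmx i).

Definition SB (k : nat) : 'M[C]_((2 * l).+1) :=
  if k == 1%N then Smx l.+1 *m Smx l *m Smx l.+1
  else Smx (l + 1 - k) *m Sbar (l + k).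

End TypeB.

Definition cartanB (i j : nat) : int :=
  if i == j then 2
  else if (i == 1%N) && (j == 2%N) then -2
  else if (i == j.+1) || (j == i.+1) then -1
  else 0.

(* Main.v *)
Require Import Defs.
From mathcomp Require Import all_boot all_order all_algebra.
From mathcomp Require Import perm complex reals zify.

(* Each S_i^B is a signed permutation matrix g with g^-1 = g^T, so Ad_g permutes
   the matrix units up to sign, and every e_j is, up to a scalar, a sum of two
   matrix units: the formulas for e_j amount to following indices. Since
   f_j = e_j^T, Ad_g commutes with transposition, and transposition is an
   anti-automorphism of the Lie bracket, the formulas for f_j follow. *)

Set Implicit Arguments.
Unset Strict Implicit.
Unset Printing Implicit Defensive.

Import Order.TTheory GRing.Theory Num.Theory.
Local Open Scope ring_scope.
Local Open Scope complex_scope.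

(** * Orthogonal matrices; linearity and transposition of [Ad] and [ad] *)

Definition orthogonal_mx (C : fieldType) n (g : 'M[C]_n) := g *m g^T = 1%:M.

Lemma orthogonal_mxM (C : fieldType) n (g h : 'M[C]_n) :
  orthogonal_mx g -> orthogonal_mx h -> orthogonal_mx (g *m h).
Proof.
rewrite /orthogonal_mx => og oh.
by rewrite trmx_mul mulmxA -(mulmxA g) oh mulmx1.
Qed.

Lemma orthogonal_unitmx (C : fieldType) n (g : 'M[C]_n) :
  orthogonal_mx g -> g \in unitmx.
Proof. by case/mulmx1_unit. Qed.

Lemma orthogonal_invmx (C : fieldType) n (g : 'M[C]_n) :
  orthogonal_mx g -> invmx g = g^T.
Proof. by move=> og; rewrite -[invmx g]mulmx1 -og mulKmx ?orthogonal_unitmx. Qed.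

Lemma orthogonal_tperm_mx (C : fieldType) n (x y : 'I_n) :
  orthogonal_mx (tperm_mx x y : 'M[C]_n).
Proof. by rewrite /orthogonal_mx tr_tperm_mx -perm_mxM tperm2 perm_mx1. Qed.

Lemma orthogonal_diag_mx (C : fieldType) n (d : 'rV[C]_n) :
  (forall j, d 0 j * d 0 j = 1) -> orthogonal_mx (diag_mx d).
Proof.
move=> dd; rewrite /orthogonal_mx tr_diag_mx mulmx_diag.
by apply/matrixP=> x y; rewrite !mxE dd.
Qed.

Lemma Ad_trmx (C : fieldType) n (g X : 'M[C]_n) :
  orthogonal_mx g -> Ad g X^T = (Ad g X)^T.
Proof.
by move=> og; rewrite /Ad orthogonal_invmx // !trmx_mul trmxK mulmxA.
Qed.

Lemma AdD (C : fieldType) n (g X Y : 'M[C]_n) : Ad g (X + Y) = Ad g X + Ad g Y.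
Proof. by rewrite /Ad mulmxDr mulmxDl. Qed.

Lemma AdZ (C : fieldType) n (g : 'M[C]_n) c X : Ad g (c *: X) = c *: Ad g X.
Proof. by rewrite /Ad -scalemxAr -scalemxAl. Qed.

Lemma ad_trmx (C : fieldType) n (X Y : 'M[C]_n) : (ad X Y)^T = - ad X^T Y^T.
Proof. by rewrite /ad /lie_bracket linearB /= !trmx_mul opprB. Qed.

Lemma adZl (C : fieldType) n c (X Y : 'M[C]_n) : ad (c *: X) Y = c *: ad X Y.
Proof. by rewrite /ad /lie_bracket -scalemxAl -scalemxAr scalerBr. Qed.

Lemma adZr (C : fieldType) n c (X Y : 'M[C]_n) : ad X (c *: Y) = c *: ad X Y.
Proof. by rewrite /ad /lie_bracket -scalemxAl -scalemxAr scalerBr. Qed.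

(** * Antitransposition and criteria for membership in so_n and O_n *)

Lemma antitrD (C : fieldType) n (X Y : 'M[C]_n) :
  antitr (X + Y) = antitr X + antitr Y.
Proof. by apply/matrixP=> x y; rewrite !mxE. Qed.

Lemma antitrZ (C : fieldType) n c (X : 'M[C]_n) :
  antitr (c *: X) = c *: antitr X.
Proof. by apply/matrixP=> x y; rewrite !mxE. Qed.

Lemma antitr_trmx (C : fieldType) n (X : 'M[C]_n) : antitr X^T = (antitr X)^T.
Proof. by apply/matrixP=> x y; rewrite !mxE. Qed.

Lemma orthogonal_sgn_mx (C : fieldType) n : orthogonal_mx (sgn_mx C n).
Proof. by apply: orthogonal_diag_mx => j; rewrite !mxE -expr2 sqrr_sign. Qed.

(** Both [antitr] and conjugation by the orthogonal matrix [sgn_mx] commute with transposition. This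
    carries membership from e_j over to f_j. *)
Lemma in_so_trmx (C : fieldType) n (X : 'M[C]_n) : in_so X -> in_so X^T.
Proof.
rewrite /in_so -!/(Ad _ _) antitr_trmx Ad_trmx; last exact: orthogonal_sgn_mx.
by move=> {1}->; rewrite linearN.
Qed.

(** Turns the entrywise [antitr] into a matrix product, so that [in_O] becomes an identity between
    products. *)
Definition rev_mx (C : fieldType) n : 'M[C]_n :=
  \matrix_(i, j) (i == rev_ord j)%:R.

Lemma antitrE (C : fieldType) n (X : 'M[C]_n) :
  antitr X = rev_mx C n *m X^T *m rev_mx C n.
Proof.
apply/matrixP=> x y; rewrite mxE mxE (bigD1 (rev_ord y)) //= big1 => [|z zy].
  rewrite !mxE (bigD1 (rev_ord x)) //= big1 => [|z zx].
    by rewrite !mxE rev_ordK !eqxx addr0 mul1r mulr1 addr0.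
  by rewrite !mxE -(inj_eq rev_ord_inj) rev_ordK eq_sym (negPf zx) mul0r.
by rewrite !mxE (negPf zy) mulr0.
Qed.

Lemma rev_mx2 (C : fieldType) n : rev_mx C n *m rev_mx C n = 1%:M.
Proof.
apply/matrixP=> x y; rewrite mxE (bigD1 (rev_ord y)) //= big1 => [|z zy].
  by rewrite !mxE rev_ordK eqxx mulr1 addr0.
by rewrite !mxE (negPf zy) mulr0.
Qed.

(* [sgn_mx *m rev_mx] is the Gram matrix of the form that O_n preserves. *)
Lemma in_O_orthogonal (C : fieldType) n (g : 'M[C]_n) :
  orthogonal_mx g ->
  g *m (sgn_mx C n *m rev_mx C n) = sgn_mx C n *m rev_mx C n *m g -> in_O g.
Proof.
move=> og gDJ; split; first exact: orthogonal_unitmx.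
have JJ := rev_mx2 C n.
have -> : invmx (antitr g) = rev_mx C n *m g *m rev_mx C n.
  have inv : antitr g *m (rev_mx C n *m g *m rev_mx C n) = 1%:M.
    rewrite antitrE -!mulmxA (mulmxA (rev_mx C n) (rev_mx C n)) JJ mul1mx.
    rewrite (mulmxA g^T); move: (mulmx1C og) => ->.
    by rewrite mul1mx JJ.
  have [uA _] := mulmx1_unit inv.
  by rewrite -[LHS]mulmx1 -inv mulKmx.
rewrite !mulmxA -gDJ -!mulmxA (mulmxA (rev_mx C n) (rev_mx C n)) JJ mul1mx.
rewrite mulmxV ?mulmx1 //; apply: orthogonal_unitmx.
exact: orthogonal_sgn_mx.
Qed.

(** * Signed permutations of natural-number indices *)

(** A transposition on naturals rather than ordinals, so that index questions reduce to linear
    arithmetic. *)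
Definition swapn (x y a : nat) : nat :=
  if a == x then y else if a == y then x else a.

(* [SB i] is a signed permutation matrix: [SB_perm] and [SB_sign] are its
   permutation and its set of negated basis vectors. *)
Definition SB_perm (l i a : nat) : nat :=
  if i == 1%N then swapn l l.+2 a
  else if (a <= l)%N then swapn (l + 1 - i) (l + 2 - i) a
  else swapn (l + i) (l + i).+1 a.

Definition SB_sign (l i a : nat) : bool :=
  (i != 1%N) && ((a == (l + i)%N) || (a == (l + i).+1)).

Ltac swapn_lia :=
  rewrite ?/SB_sign ?/SB_perm ?/swapn /=;
  repeat match goal with
  | |- context [if ?x == ?y then _ else _] => case: (x =P y)
  | |- context [if (?x <= ?y)%N then _ else _] => case: (leqP x y)
  end; lia.

Section TypeB.

Variables (C : numClosedFieldType) (l : nat).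
Implicit Types i j a b c d : nat.

Local Notation N := (2 * l).+1.
Local Notation E := (munit C l).

(** * Indices from 1, basis vectors and matrix units *)

Lemma val_idx a : (1 <= a <= N)%N -> idx l a = a.-1 :> nat.
Proof. by move=> ha; rewrite /idx inordK //; lia. Qed.

Lemma idx_eq a b : (1 <= a <= N)%N -> (1 <= b <= N)%N ->
  (idx l a == idx l b) = (a == b).
Proof. by move=> ha hb; rewrite -val_eqE /= !val_idx //; lia. Qed.

Lemma idx_onto (x : 'I_N) : x = idx l x.+1 /\ (1 <= x.+1 <= N)%N.
Proof.
have hx : (1 <= x.+1 <= N)%N by have := ltn_ord x; lia.
by split=> //; apply/val_inj; rewrite /= val_idx.
Qed.

Definition bvec a : 'cV[C]_N := delta_mx (idx l a) 0.

Lemma munit_bvec a b : E a b = bvec a *m (bvec b)^T.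
Proof. by rewrite /bvec trmx_delta mul_delta_mx. Qed.

Lemma munit_tr a b : (E a b)^T = E b a.
Proof. exact: trmx_delta. Qed.

Lemma munit_mul a b c d : (1 <= b <= N)%N -> (1 <= c <= N)%N ->
  E a b *m E c d = if b == c then E a d else 0.
Proof.
move=> hb hc; rewrite /munit mul_delta_mx_cond idx_eq //.
by case: ifP.
Qed.

Lemma eq_mx_bvec (A B : 'M[C]_N) :
  (forall a, (1 <= a <= N)%N -> A *m bvec a = B *m bvec a) -> A = B.
Proof.
move=> AB; apply/matrixP=> x y; have [yE hy] := idx_onto y.
by have /colP/(_ x) := AB _ hy; rewrite /bvec -!colE -yE !mxE => ->.
Qed.

Lemma tperm_mx_bvec a b c :
    (1 <= a <= N)%N -> (1 <= b <= N)%N -> (1 <= c <= N)%N ->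
  tperm_mx (idx l a) (idx l b) *m bvec c = bvec (swapn a b c).
Proof.
move=> ha hb hc; apply/colP=> x; rewrite /bvec -xrowE !mxE eqxx !andbT.
(* The matrix acts by permuting row indices; as the transposition is its own inverse, it can be
   moved to the index of the basis vector. *)
rewrite (can2_eq (tpermK _ _) (tpermK _ _)) /swapn.
congr (nat_of_bool (_ == _))%:R; rewrite -(idx_eq hc ha) -(idx_eq hc hb).
by case: tpermP => [->|->|/eqP/negPf-> /eqP/negPf->] //; rewrite eqxx //; case: eqP.
Qed.

Lemma diag_mx_bvec (d : 'rV[C]_N) a :
  diag_mx d *m bvec a = d 0 (idx l a) *: bvec a.
Proof.
apply/colP=> x; rewrite mul_diag_mx !mxE.
by case: (x =P idx l a) => [->|_] //=; rewrite !mulr0.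
Qed.

Lemma rev_mx_bvec a : (1 <= a <= N)%N ->
  rev_mx C N *m bvec a = bvec (N.+1 - a).
Proof.
move=> ha; apply/colP=> x; rewrite /bvec -colE !mxE eqxx andbT.
congr (nat_of_bool (_ == _))%:R; apply/val_inj => /=; rewrite !val_idx //; lia.
Qed.

Lemma sgn_mx_bvec a : (1 <= a <= N)%N ->
  sgn_mx C N *m bvec a = (-1) ^+ a.-1 *: bvec a.
Proof. by move=> ha; rewrite diag_mx_bvec !mxE val_idx. Qed.

(** * Action of S_i^B on basis vectors and matrix units *)

Lemma orthogonal_Tmx i : orthogonal_mx (Tmx C l i).
Proof.
by apply: orthogonal_diag_mx => j; rewrite mxE; case: ifP; rewrite ?mulrNN mulr1.
Qed.

Lemma SbarE i : Sbar C l i = Tmx C l i *m Smx C l i *m Tmx C l i.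
Proof.
by rewrite /Sbar orthogonal_invmx ?tr_diag_mx //; apply: orthogonal_Tmx.
Qed.

Lemma orthogonal_SB i : orthogonal_mx (SB C l i).
Proof.
have oS k : orthogonal_mx (Smx C l k) by exact: orthogonal_tperm_mx.
have oT := orthogonal_Tmx.
by rewrite /SB; case: ifP => _; rewrite ?SbarE; do ![apply: orthogonal_mxM => //].
Qed.

(** T_k negates only the vector of index k. When a is k or k+1, exactly one of a and its image is k,
    so exactly one of the two factors T_k contributes a sign. *)
Lemma Sbar_bvec k a : (1 <= k <= 2 * l)%N -> (1 <= a <= N)%N ->
  Sbar C l k *m bvec a =
    (-1) ^+ ((a == k) || (a == k.+1)) *: bvec (swapn k k.+1 a).
Proof.
move=> hk ha; rewrite SbarE /Smx -!mulmxA !diag_mx_bvec -!scalemxAr.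
rewrite tperm_mx_bvec ?diag_mx_bvec ?scalerA ?mxE ?idx_eq; try swapn_lia.
congr (_ *: _); rewrite /swapn.
have kk : (k.+1 == k) = false by lia.
case: (a =P k) => [_|/eqP/negPf ak]; last case: (a =P k.+1) => _.
all: by rewrite ?kk ?ak ?eqxx /= ?mul1r ?mulr1.
Qed.

Lemma SB_bvec i a : (1 <= i <= l)%N -> (1 <= a <= N)%N ->
  SB C l i *m bvec a = (-1) ^+ SB_sign l i a *: bvec (SB_perm l i a).
Proof.
move=> hi ha; rewrite /SB /SB_perm /SB_sign; case: eqP => /= [i1|i1].
  (* Conjugating (l l+1) by (l+1 l+2) gives the transposition (l l+2). *)
  rewrite expr0 scale1r /Smx -!mulmxA.
  rewrite !tperm_mx_bvec //; try swapn_lia.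
  congr bvec; swapn_lia.
(* For i > 1 the two factors move disjoint sets of indices, one below l+1 and one above it. *)
rewrite -mulmxA Sbar_bvec -?scalemxAr ?tperm_mx_bvec //; try swapn_lia.
by congr (_ *: bvec _); swapn_lia.
Qed.

(** With v_a the basis vectors, g v_a v_b^T g^-1 = (g v_a)(g v_b)^T because g^-1 = g^T. *)
Lemma Ad_munit g x y a b a' b' : orthogonal_mx g ->
    g *m bvec a = x *: bvec a' -> g *m bvec b = y *: bvec b' ->
  Ad g (E a b) = (x * y) *: E a' b'.
Proof.
move=> og ga gb; rewrite /Ad (orthogonal_invmx og) !munit_bvec.
rewrite mulmxA -mulmxA -trmx_mul ga gb linearZ /= -scalemxAl -scalemxAr.
by rewrite scalerA.
Qed.

Lemma Ad_SB_munit i a b :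
    (1 <= i <= l)%N -> (1 <= a <= N)%N -> (1 <= b <= N)%N ->
  Ad (SB C l i) (E a b) =
    (-1) ^+ (SB_sign l i a (+) SB_sign l i b) *: E (SB_perm l i a) (SB_perm l i b).
Proof.
move=> hi ha hb; rewrite signr_addb.
by apply: Ad_munit; [apply: orthogonal_SB | apply: SB_bvec..].
Qed.

Lemma SB_perm_bounds i a : (1 <= i <= l)%N -> (1 <= a <= N)%N ->
  (1 <= SB_perm l i a <= N)%N.
Proof. move=> hi ha; swapn_lia. Qed.

(** * Membership of S_i^B in the orthogonal group *)

(** The reversal a -> 2l+2-a exchanges the swapped pairs {l+1-i, l+2-i} and {l+i, l+i+1}; for i = 1
    it exchanges l and l+2. *)
Lemma SB_perm_rev i a : (1 <= i <= l)%N -> (1 <= a <= N)%N ->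
  SB_perm l i (N.+1 - a) = (N.+1 - SB_perm l i a)%N.
Proof. move=> hi ha; swapn_lia. Qed.

(* [antitr] exchanges the plain and the negated transposition of [SB i]; the
   sign change is the one produced by conjugation with [sgn_mx]. *)
Lemma SB_sign_rev i a : (1 <= i <= l)%N -> (1 <= a <= N)%N ->
  odd (N.+1 - a).-1 (+) SB_sign l i (N.+1 - a) =
  SB_sign l i a (+) odd (SB_perm l i (N.+1 - a)).-1.
Proof. move=> hi ha; rewrite SB_perm_rev //; swapn_lia. Qed.

Lemma in_O_SB i : (1 <= i <= l)%N -> in_O (SB C l i).
Proof.
move=> hi; apply: in_O_orthogonal; first exact: orthogonal_SB.
apply: eq_mx_bvec => a ha; rewrite -!mulmxA rev_mx_bvec // SB_bvec //.
have ha' : (1 <= N.+1 - a <= N)%N by lia.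
have hp := SB_perm_bounds hi ha; have hp' := SB_perm_bounds hi ha'.
rewrite sgn_mx_bvec // -!scalemxAr SB_bvec // rev_mx_bvec // sgn_mx_bvec; last lia.
rewrite !scalerA -SB_perm_rev //; congr (_ *: _).
rewrite -(signr_odd _ (N.+1 - a).-1) -(signr_odd _ (SB_perm l i _).-1).
by rewrite -!signr_addb SB_sign_rev.
Qed.

(** * The Chevalley generators and their membership in so *)

(* The generator [e_1] has the shape of the others up to the factor [sqrt 2]. *)
Definition chev_coef j : C := if j == 1%N then sqrtC 2 else 1.

Definition chev_sum j : 'M[C]_N :=
  E (l + 1 - j) (l + 2 - j) + E (l + j) (l + 1 + j).

Lemma chev_eE j : (1 <= j)%N -> chev_e C l j = chev_coef j *: chev_sum j.
Proof.
rewrite /chev_e /chev_coef /chev_sum => hj.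
case: eqP => [->|_]; last by rewrite scale1r.
by congr (_ *: (munit C l _ _ + munit C l _ _)); lia.
Qed.

Lemma chev_fE j : chev_f C l j = (chev_e C l j)^T.
Proof.
by rewrite /chev_f /chev_e; case: ifP => _;
  rewrite ?[(_ *: _)^T]linearZ /= [(_ + _)^T]linearD /= !munit_tr.
Qed.

Lemma antitr_munit a b : (1 <= a <= N)%N -> (1 <= b <= N)%N ->
  antitr (E a b) = E (N.+1 - b) (N.+1 - a).
Proof.
move=> ha hb; apply/matrixP=> x y; rewrite !mxE andbC; congr (_ && _)%:R;
  by rewrite -!val_eqE /= !val_idx //; have := ltn_ord x; have := ltn_ord y; lia.
Qed.

Lemma Ad_sgn_munit a b : (1 <= a <= N)%N -> (1 <= b <= N)%N ->
  Ad (sgn_mx C N) (E a b) = (-1) ^+ (a + b) *: E a b.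
Proof.
move=> ha hb; rewrite (Ad_munit (orthogonal_sgn_mx C N)
  (sgn_mx_bvec ha) (sgn_mx_bvec hb)).
case: a b ha hb => [|a] [|b] //= _ _.
by rewrite addSn addnS !exprS mulrA mulrNN !mul1r exprD.
Qed.

(** [antitr] exchanges the two matrix units of e_j, and conjugation by [sgn_mx] negates each of them
    because its row and column indices have odd sum. *)
Lemma in_so_e j : (1 <= j <= l)%N -> in_so (chev_e C l j).
Proof.
move=> hj.
rewrite /in_so -/(Ad _ _) chev_eE ?antitrZ ?AdZ ?antitrD; last lia.
rewrite !antitr_munit ?AdD; try lia.
rewrite -scalerN opprD addrC; congr (_ *: (_ + _)).
all: rewrite Ad_sgn_munit; try lia.
all: rewrite -scaleNr -signr_odd (_ : odd _ = true); last lia.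
all: by rewrite opprK scale1r; congr munit; lia.
Qed.

Lemma chev_sum_tr j :
  (chev_sum j)^T = E (l + 2 - j) (l + 1 - j) + E (l + 1 + j) (l + j).
Proof. by rewrite [(_ + _)^T]linearD /= !munit_tr. Qed.

(** * Ad of S_i^B on generators, compared with brackets *)

(** Target indices and sign are free parameters, so that each use names the expected result and
    leaves only index arithmetic. *)
Lemma Ad_SB_eq i a b a' b' n :
    (1 <= i <= l)%N -> (1 <= a <= N)%N -> (1 <= b <= N)%N ->
    SB_perm l i a = a' -> SB_perm l i b = b' ->
    SB_sign l i a (+) SB_sign l i b = n ->
  Ad (SB C l i) (E a b) = (-1) ^+ n *: E a' b'.
Proof. by move=> hi ha hb <- <- <-; apply: Ad_SB_munit. Qed.

Lemma Ad_SB_same i : (1 <= i <= l)%N ->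
  Ad (SB C l i) (chev_sum i) = (chev_sum i)^T.
Proof.
move=> hi; rewrite chev_sum_tr AdD; case: (i =P 1%N) hi => [->|i1] hi.
  (* For i = 1 each matrix unit goes to the transpose of the other one; for i > 1 each goes to its
     own transpose. *)
  rewrite (@Ad_SB_eq 1 _ _ (l + 1 + 1) (l + 1) false); try swapn_lia.
  rewrite (@Ad_SB_eq 1 _ _ (l + 2 - 1) (l + 1 - 1) false); try swapn_lia.
  by rewrite !scale1r addrC.
rewrite (@Ad_SB_eq i _ _ (l + 2 - i) (l + 1 - i) false); try swapn_lia.
rewrite (@Ad_SB_eq i _ _ (l + 1 + i) (l + i) false); try swapn_lia.
by rewrite !scale1r.
Qed.

(** No index occurring in [chev_sum j] is moved or negated by S_i^B. *)
Lemma Ad_SB_far i j : (1 <= i <= l)%N -> (1 <= j <= l)%N ->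
  (i.+1 < j)%N || (j.+1 < i)%N -> Ad (SB C l i) (chev_sum j) = chev_sum j.
Proof.
move=> hi hj hij; rewrite AdD.
rewrite (@Ad_SB_eq i _ _ (l + 1 - j) (l + 2 - j) false); try swapn_lia.
rewrite (@Ad_SB_eq i _ _ (l + j) (l + 1 + j) false); try swapn_lia.
by rewrite !scale1r.
Qed.

Ltac munit_mul_lia :=
  rewrite ?mulmxDl ?mulmxDr ?mulNmx ?mulmxN ?munit_mul; try lia;
  repeat match goal with
  | |- context [if ?x == ?y then _ else _] =>
    case: (x =P y) => ?; try (exfalso; lia)
  end;
  do ?rewrite (addr0, add0r, subr0, sub0r, oppr0, opprK).

Lemma ad_chev_sum_succ i : (1 <= i < l)%N ->
  ad (chev_sum i) (chev_sum i.+1) =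
  E (l + i) (l + 2 + i) - E (l - i) (l + 2 - i).
Proof.
move=> hi; rewrite /ad /lie_bracket.
munit_mul_lia.
by congr (munit C l _ _ - munit C l _ _); lia.
Qed.

(** Both units of [chev_sum 1] involve the middle index l+1, through which the second bracket
    extends each term of the first. *)
Lemma ad2_chev_sum : (1 < l)%N ->
  ad (chev_sum 1) (ad (chev_sum 1) (chev_sum 2)) =
  E l (l + 3) + E (l - 1) (l + 2).
Proof.
move=> hl; rewrite ad_chev_sum_succ // /ad /lie_bracket.
munit_mul_lia.
by congr (munit C l _ _ + munit C l _ _); lia.
Qed.

Lemma ad_chev_sum_pred i : (1 <= i < l)%N ->
  ad (chev_sum i.+1) (chev_sum i) =
  E (l - i) (l + 2 - i) - E (l + i) (l + 2 + i).
Proof.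
move=> /ad_chev_sum_succ h.
by rewrite -[LHS]opprB -/(lie_bracket _ _) -/(ad _ _) h opprB.
Qed.

(** The relative sign of the two terms arises because, of the four indices in [chev_sum i.+1], only
    l+i+1 is negated by S_i^B. *)
Lemma Ad_SB_succ i : (1 < i < l)%N ->
  Ad (SB C l i) (chev_sum i.+1) = - ad (chev_sum i) (chev_sum i.+1).
Proof.
move=> hi; rewrite AdD ad_chev_sum_succ ?opprB; last lia.
rewrite (@Ad_SB_eq i _ _ (l - i) (l + 2 - i) false); try swapn_lia.
rewrite (@Ad_SB_eq i _ _ (l + i) (l + 2 + i) true); try swapn_lia.
by rewrite scale1r scaleN1r.
Qed.

Lemma Ad_SB_pred i : (1 <= i < l)%N ->
  Ad (SB C l i.+1) (chev_sum i) = ad (chev_sum i.+1) (chev_sum i).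
Proof.
move=> hi; rewrite AdD ad_chev_sum_pred //.
rewrite (@Ad_SB_eq i.+1 _ _ (l - i) (l + 2 - i) false); try swapn_lia.
rewrite (@Ad_SB_eq i.+1 _ _ (l + i) (l + 2 + i) true); try swapn_lia.
by rewrite scale1r scaleN1r.
Qed.

Lemma Ad_SB_1_2 : (1 < l)%N ->
  Ad (SB C l 1) (chev_sum 2) = ad (chev_sum 1) (ad (chev_sum 1) (chev_sum 2)).
Proof.
move=> hl; rewrite AdD ad2_chev_sum //.
rewrite (@Ad_SB_eq 1 _ _ (l - 1) (l + 2) false); try swapn_lia.
rewrite (@Ad_SB_eq 1 _ _ l (l + 3) false); try swapn_lia.
by rewrite !scale1r addrC.
Qed.

(** * The formulas for e_j and f_j *)

Lemma Ad_SB_e i j : (1 <= i <= l)%N -> (1 <= j <= l)%N ->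
  let s := SB C l i in
  let e := chev_e C l in
  let a := cartanB i j in
  [/\ i = j -> Ad s (e j) = chev_f C l j,
      1 < `|i%:Z - j%:Z| -> Ad s (e j) = e j,
      i%:Z - j%:Z = -1 ->
        Ad s (e j) =
          - ((-1) ^+ (i == 1%N) / (`|a|%N`!)%:R) *: iter `|- a|%N (ad (e i)) (e j)
    & i%:Z - j%:Z = 1 -> Ad s (e j) = ad (e i) (e j)].
Proof.
move=> hi hj s e a; rewrite /s /e chev_fE !chev_eE; try lia.
have coef1 k : (1 < k)%N -> chev_coef k = 1.
  by rewrite /chev_coef; case: eqP => // ->.
rewrite AdZ !(adZl, adZr); split=> hij.
- by rewrite -hij Ad_SB_same // [(_ *: _)^T]linearZ.
- by rewrite Ad_SB_far //; lia.
- have jE : j = i.+1 by lia.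
  rewrite /a {}jE in hj *; case: (eqVneq i 1%N) => [i1|i1].
    (* The two copies of e_1 contribute (sqrt 2)^2 = 2, which cancels 2!, while -(-1)^1 = 1. *)
    rewrite i1 /= /chev_coef !eqxx /= !(adZl, adZr) Ad_SB_1_2; last lia.
    rewrite scale1r expr1 !scalerA -expr2 sqrtCK.
    by rewrite mulN1r opprK mulVf ?scale1r // pnatr_eq0.
  have -> : cartanB i i.+1 = -1.
    by rewrite /cartanB; do !case: eqP => //=; lia.
  rewrite /= !(adZl, adZr) Ad_SB_succ; last lia.
  rewrite !coef1 ?scale1r; try lia.
  by rewrite expr0 divr1 scaleN1r.
have iE : i = j.+1 by lia.
(* Here i > 1, so only e_j can carry sqrt 2, and that factor stands on both sides. *)
rewrite {}iE in hi *; rewrite Ad_SB_pred; last lia.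
by rewrite (coef1 j.+1) ?scale1r; last lia.
Qed.

Lemma iter_ad_trmx k (X Y : 'M[C]_N) :
  (iter k (ad X) Y)^T = (-1) ^+ k *: iter k (ad X^T) Y^T.
Proof.
elim: k => [|k IHk] /=; first by rewrite scale1r.
by rewrite ad_trmx IHk adZr exprS mulN1r scaleNr.
Qed.

Lemma Ad_SB_f i j : (1 <= i <= l)%N -> (1 <= j <= l)%N ->
  let s := SB C l i in
  let e := chev_e C l in
  let f := chev_f C l in
  let a := cartanB i j in
  [/\ i = j -> Ad s (f j) = e j,
      1 < `|i%:Z - j%:Z| -> Ad s (f j) = f j,
      i%:Z - j%:Z = -1 ->
        Ad s (f j) = (`|a|%N`!)%:R^-1 *: iter `|- a|%N (ad (f i)) (f j)
    & i%:Z - j%:Z = 1 -> Ad s (f j) = - ad (f i) (f j)].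
Proof.
move=> hi hj s e f a; have [e0 e1 e2 e3] := Ad_SB_e hi hj.
rewrite /f !chev_fE Ad_trmx; last exact: orthogonal_SB.
split=> hij.
- by rewrite e0 // chev_fE trmxK.
- by rewrite e1.
- rewrite e2 // [(_ *: _)^T]linearZ /= iter_ad_trmx scalerA.
  congr (_ *: _); rewrite -/a.
  (* Transposing the -a nested brackets gives this sign, which cancels the one in the formula for
     e_j: -a is 2 for i = 1 and 1 otherwise. *)
  have -> : (-1) ^+ `|- a|%N = - (-1) ^+ (i == 1%N) :> C.
    have jE : j = i.+1 by lia.
    rewrite /a jE /cartanB; case: (eqVneq i 1%N) => [->|i1].
      by rewrite /= expr1 opprK sqrrN expr1n.
    have -> : (i == i.+1) = false by lia.
    by rewrite eqxx orbT /= expr0.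
  by rewrite mulrNN mulrAC -signr_addb addbb mul1r.
by rewrite e3 // ad_trmx.
Qed.

End TypeB.

Theorem proposition9p3 (R : realType) (l i j : nat)
    (hl : (1 <= l)%N) (hi : (1 <= i <= l)%N) (hj : (1 <= j <= l)%N) :
  let s := SB R[i] l i in
  let e := chev_e R[i] l in
  let f := chev_f R[i] l in
  let a := cartanB i j in
  [/\ in_O s, in_so (e j) & in_so (f j)]
  /\
  [/\ i = j -> Ad s (e j) = f j,
      1 < `|i%:Z - j%:Z| -> Ad s (e j) = e j,
      i%:Z - j%:Z = -1 ->
        Ad s (e j) =
          - ((-1) ^+ (i == 1%N) / (`|a|%N`!)%:R) *: iter `|- a|%N (ad (e i)) (e j)
    & i%:Z - j%:Z = 1 -> Ad s (e j) = ad (e i) (e j)]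
  /\
  [/\ i = j -> Ad s (f j) = e j,
      1 < `|i%:Z - j%:Z| -> Ad s (f j) = f j,
      i%:Z - j%:Z = -1 ->
        Ad s (f j) = (`|a|%N`!)%:R^-1 *: iter `|- a|%N (ad (f i)) (f j)
    & i%:Z - j%:Z = 1 -> Ad s (f j) = - ad (f i) (f j)].
Proof.
split; last by split; [exact: Ad_SB_e | exact: Ad_SB_f].
split; [exact: in_O_SB | exact: in_so_e |].
by rewrite chev_fE; apply: in_so_trmx; exact: in_so_e.
Qed.
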